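(* Let $G$ be a graph with $diam(G)=2$. Then: (1) if $G$ has a cut-vertex, then $md(G)$ is equal to the number of blocks of $G$; (2) if $G$ is a $2$-connected graph, then $md(G)\leq 2$; (3) if any two nonadjacent vertices of $G$ have at least two common neighbors, then $md(G)\leq 2$, and equality holds if and only if $G=K_s\Box K_t$ (up to isomorphism) for some integers $s,t\geq 2$.
   Context: Graphs are finite and simple. $diam(G)$ is the diameter of $G$ (finite diameter implies connected). An edge-coloring of $G$ assigns a color (positive integer) to each edge; adjacent edges may have the same color. An edge-cut is monochromatic if all of its edges have the same color. An edge-coloring of $G$ is a monochromatic disconnection coloring ($MD$-coloring) if every two distinct vertices of $G$ are separated by a monochromatic edge-cut (i.e. there is a set of edges of a single color whose deletion puts the two vertices in different components). For a connected graph $G$, $md(G)$ is the maximum number of colors used in an $MD$-coloring of $G$. $K_s\Box K_t$ denotes the Cartesian product of complete graphs: vertices are pairs $(u,v)$, with $(u,v)$ and $(x,y)$ adjacent if $ux$ is an edge of $K_s$ and $v=y$, or $vy$ is an edge of $K_t$ and $u=x$. *)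

(* Defs.v *)
From mathcomp Require Import all_boot.
From mathcomp Require Import boolp.

Set Implicit Arguments.
Unset Strict Implicit.
Unset Printing Implicit Defensive.

Record sgraph := SGraph {
  vertex :> finType;
  adj : rel vertex;
  adj_sym : symmetric adj;
  adj_irr : irreflexive adj }.

Section Graph.
Variable G : sgraph.

Definition edges : {set {set G}} :=
  [set [set p.1; p.2] | p : G * G & adj p.1 p.2].

Lemma edgesE (x y : G) : ([set x; y] \in edges) = adj x y.
Proof.
apply/imsetP/idP => [[[a b] /=]|xy]; last by exists (x, y); rewrite ?inE.
rewrite inE /= => ab E.
have nab : a != b by apply: contraTneq ab => ->; rewrite adj_irr.
have : x \in [set a; b] by rewrite -E set21.
have : y \in [set a; b] by rewrite -E set22.
have : a \in [set x; y] by rewrite E set21.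
have : b \in [set x; y] by rewrite E set22.
rewrite !inE => bxy axy /orP[] /eqP yE /orP[] /eqP xE; subst x y => //.
- by move: bxy; rewrite orbb eq_sym (negPf nab).
- by rewrite adj_sym.
- by move: axy; rewrite orbb (negPf nab).
Qed.

Definition walk (k : nat) (x y : G) : bool :=
  [exists p : k.-tuple G, path (@adj G) x p && (last x p == y)].

(* dist(x, y) = k; no k qualifies when the distance is infinite. *)
Definition has_dist (x y : G) (k : nat) : Prop :=
  walk k x y /\ forall j, walk j x y -> k <= j.

Definition has_diam (d : nat) : Prop :=
  (forall x y, exists2 k, has_dist x y k & k <= d) /\
  (exists x y, has_dist x y d).

(* A pair (V, F) stands for the graph with vertex set V and edge set F; it is  *)
(* a subgraph of G when [is_subgraph] holds.                                   *)
Definition subgraph : Type := ({set G} * {set {set G}})%type.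
Implicit Types H K : subgraph.

Definition whole : subgraph := ([set: G], edges).

Definition is_subgraph H : bool :=
  (H.2 \subset edges) && [forall f in H.2, f \subset H.1].

Definition le_subgraph H K : bool := (H.1 \subset K.1) && (H.2 \subset K.2).

Definition sadj H : rel G := [rel x y | [set x; y] \in H.2].

Definition connected H : bool :=
  (H.1 != set0) && [forall x in H.1, forall y in H.1, connect (sadj H) x y].

Definition ncomp H : nat := n_comp (sadj H) H.1.

Definition del_vertices H (X : {set G}) : subgraph :=
  (H.1 :\: X, [set f in H.2 | [disjoint f & X]]).

Definition del_edges H (S : {set {set G}}) : subgraph := (H.1, H.2 :\: S).

Definition cut_vertex H (v : G) : bool :=
  (v \in H.1) && (ncomp H < ncomp (del_vertices H [set v])).

Definition nonseparable H : bool :=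
  [&& is_subgraph H, connected H & [forall v, ~~ cut_vertex H v]].

Definition block H : bool :=
  nonseparable H &&
  [forall K : subgraph, nonseparable K ==> le_subgraph H K ==> (K == H)].

Definition nblocks : nat := #|[set H : subgraph | block H]|.

Definition k_connected (k : nat) : Prop :=
  k < #|G| /\
  forall X : {set G}, #|X| < k -> connected (del_vertices whole X).

(* Colorings are total functions on sets of vertices; only their values on     *)
(* edges matter.                                                               *)
Implicit Type c : {set G} -> nat.

Definition edge_coloring c : Prop := forall f, f \in edges -> 0 < c f.

Definition ncolors c : nat := size (undup [seq c f | f in edges]).

Definition monochromatic c (S : {set {set G}}) : Prop :=
  forall f g, f \in S -> g \in S -> c f = c g.

Definition separates (S : {set {set G}}) (x y : G) : Prop :=
  ~ connect (sadj (del_edges whole S)) x y.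

Definition md_coloring c : Prop :=
  edge_coloring c /\
  forall x y : G, x != y ->
    exists S : {set {set G}}, [/\ S \subset edges, monochromatic c S & separates S x y].

(* The bound on k is harmless: a coloring uses at most #|edges| colors; [md_ex] *)
(* and [md_max] state that the maximum is attained and is an upper bound.       *)
Definition md : nat :=
  \max_(k < #|edges|.+1 | `[< exists2 c, md_coloring c & ncolors c = k >]) k.

Lemma ncolors_le c : ncolors c <= #|edges|.
Proof. by rewrite (leq_trans (size_undup _))// size_image. Qed.

Lemma md_max c : md_coloring c -> ncolors c <= md.
Proof.
move=> mdc; have lt : ncolors c < #|edges|.+1 by rewrite ltnS ncolors_le.
apply: (@leq_bigmax_cond _ _ (fun k : 'I_#|edges|.+1 => val k) (Ordinal lt)).
by apply/asboolP; exists c.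
Qed.

Lemma md_coloring1 : md_coloring (fun=> 1).
Proof.
split=> // x y xy; exists edges; split=> //; rewrite /separates.
move=> /connectP[[|z p] /= + E]; first by rewrite E eqxx in xy.
by rewrite /sadj /= in_setD andNb.
Qed.

Lemma md_ex : exists2 c, md_coloring c & ncolors c = md.
Proof.
have lt : ncolors (fun=> 1) < #|edges|.+1 by rewrite ltnS ncolors_le.
pose P (k : 'I_#|edges|.+1) := `[< exists2 c, md_coloring c & ncolors c = k >].
have P1 : P (Ordinal lt) by apply/asboolP; exists (fun=> 1); first exact: md_coloring1.
rewrite /md (bigmax_eq_arg (Ordinal lt))//.
by case: arg_maxnP => // k /asboolP.
Qed.

End Graph.

Definition isomorphic (G H : sgraph) : Prop :=
  exists2 f : G -> H, bijective f & forall x y, adj (f x) (f y) = adj x y.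

Section Complete.
Variable n : nat.
Definition K_adj : rel 'I_n := [rel x y | x != y].
Lemma K_sym : symmetric K_adj. Proof. by move=> x y; rewrite /K_adj /= eq_sym. Qed.
Lemma K_irr : irreflexive K_adj. Proof. by move=> x; rewrite /K_adj /= eqxx. Qed.
Definition complete : sgraph := SGraph K_sym K_irr.
End Complete.

Section CartesianProduct.
Variables G H : sgraph.
Definition cart_adj : rel (G * H) :=
  [rel p q | adj p.1 q.1 && (p.2 == q.2) || adj p.2 q.2 && (p.1 == q.1)].
Lemma cart_sym : symmetric cart_adj.
Proof.
move=> p q; rewrite /cart_adj /=.
by rewrite (adj_sym p.1) (adj_sym p.2) (eq_sym p.1) (eq_sym p.2).
Qed.
Lemma cart_irr : irreflexive cart_adj.
Proof. by move=> p; rewrite /cart_adj /= !adj_irr. Qed.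
Definition cartesian : sgraph := SGraph cart_sym cart_irr.
End CartesianProduct.

(* Main.v *)
Require Import Defs.
From mathcomp Require Import all_boot.

Set Implicit Arguments.
Unset Strict Implicit.
Unset Printing Implicit Defensive.

(** Fix an MD-coloring c and call two vertices i-separated when no path free of
    color i joins them ([~~ side c i x y]).  Distinct vertices are i-separated
    for some i, so x is determined by its coordinates, the coordinate i being
    its class under [side c i].  An edge of color i changes the coordinate i
    and no other ([side_edge]).  An MD-coloring is thus an embedding of G in a
    Hamming graph (a product of complete graphs), with the coordinate that an
    edge changes as its color.

    - The bound.  In diameter two, any two vertices differ in at most two
      coordinates ([differ_in_two]), and if v differs from b in two of them,
      these are the colors of all edges at b ([edge_colored_by_difference]).
      Let three colors occur.  Some vertex b meets two colors p and q; by the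
      above, a vertex differing from b in a third coordinate r differs from it
      in r only, which forces an edge of color r at b.  Now that three colors
      meet at b, every other vertex is b with one coordinate changed, and a
      walk avoiding b never changes which one: b separates its p-neighbors from
      its q-neighbors ([three_colors_separated]).  Such a vertex b exists
      neither in a 2-connected graph nor in one whose nonadjacent pairs have
      two common neighbors, so md(G) <= 2 in both cases.

    - Equality.  Suppose nonadjacent pairs have two common neighbors and the
      colors are p and q.  The two common neighbors of vertices that differ in
      both coordinates are the two other corners of a rectangle ([corner]).  So
      all pairs of coordinates occur, and completing rectangles also shows that
      vertices sharing a coordinate are adjacent ([same_coordinate_adj]): G is
      the product of two complete graphs.  Conversely, coloring the edges of
      such a product by the coordinate they change is an MD-coloring.

    - Cut-vertex.  A cut-vertex v is adjacent to all other vertices, because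
      the middle of a path of length two between different components of G - v
      must be v.  Hence the blocks are the components of G - v, each with v
      added ([blocksE]).  Triangles are monochromatic ([triangle_mono]), and
      triangles through v link all the edges of a block, so md(G) is at most
      the number of blocks; one color per block attains it. *)

(** * Coordinates of a vertex under an MD-coloring *)

Section Sides.
Variable G : sgraph.
Implicit Types (c : {set G} -> nat) (x y z : G).

Definition other_colors c (i : nat) : rel G :=
  [rel x y | adj x y && (c [set x; y] != i)].

Definition side c (i : nat) : rel G := connect (other_colors c i).

Lemma side_refl c i x : side c i x x.
Proof. exact: connect0. Qed.

Lemma side_csym c i : connect_sym (other_colors c i).
Proof.
by apply: sym_connect_sym => x y; rewrite /other_colors /= adj_sym setUC.
Qed.

Lemma side_sym c i x y : side c i x y = side c i y x.
Proof. exact: side_csym. Qed.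

Lemma side_trans c i x y z : side c i x y -> side c i y z -> side c i x z.
Proof. exact: connect_trans. Qed.

Lemma side_congl c i x y z : side c i x y -> side c i x z = side c i y z.
Proof. by move=> xy; apply: same_connect xy _; apply: side_csym. Qed.

Lemma side_split c i x y z :
  ~~ side c i x z -> ~~ side c i x y \/ ~~ side c i y z.
Proof.
move=> xz; case: (boolP (side c i x y)) => [xy|]; last by left.
by right; rewrite -(side_congl _ xy).
Qed.

(** A monochromatic cut may be enlarged to the whole class of its color. If the
    cut is empty, x and y lie in different components of G and any i will do. *)
Lemma md_coloringP c :
  md_coloring c <->
  edge_coloring c /\ forall x y, x != y -> exists i, ~~ side c i x y.
Proof.
split=> -[cpos sep]; split=> // x y xy.
  have [S [SE Smono Sxy]] := sep x y xy.
  have [i iP] : exists i, forall f, f \in S -> c f = i.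
    have [->|[f fS]] := set_0Vmem S; first by exists 0 => f; rewrite inE.
    by exists (c f) => g gS; apply: Smono.
  exists i; apply/negP => cxy; apply: Sxy; apply: connect_sub cxy => u w.
  move=> /andP[uw cuw]; apply: connect1.
  rewrite /sadj /= inE edgesE uw andbT.
  by apply: contra cuw => /iP ->.
have [i nxy] := sep x y xy; exists [set f in edges G | c f == i]; split.
- by apply/subsetP => f; rewrite inE => /andP[].
- by move=> f g; rewrite !inE => /andP[_ /eqP->] /andP[_ /eqP->].
move=> cxy; move/negP: nxy; apply; apply: connect_sub cxy => u w.
rewrite /sadj /= !inE !edgesE negb_and => /andP[+ uw]; rewrite uw /= => cuw.
by apply: connect1; rewrite /other_colors /= uw.
Qed.

(** An edge of color j lies in G minus any other color, so its ends have to be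
    separated by j itself: it changes the coordinate j and only that one. *)
Lemma side_edge c i x y :
  md_coloring c -> adj x y -> side c i x y = (c [set x; y] != i).
Proof.
move=> /md_coloringP[_ sep] xy.
have keepE j : c [set x; y] != j -> side c j x y.
  by move=> cj; apply: connect1; rewrite /other_colors /= xy.
apply/idP/idP => [sxy|]; last exact: keepE.
have [|j nj] := sep x y; first by apply: contraTneq xy => ->; rewrite adj_irr.
apply: contraNneq nj => ci.
case: (eqVneq (c [set x; y]) j) => [<-|/keepE//].
by rewrite ci.
Qed.

(** To separate the ends of a side, the other two sides have to be cut as well:
    one of them shares the color of the side. This holds for each of the three
    sides, so all three colors agree. *)
Lemma triangle_mono c x y z :
  md_coloring c -> adj x y -> adj y z -> adj x z -> c [set x; y] = c [set x; z].
Proof.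
move=> mdc xy yz xz; have zy : adj z y by rewrite adj_sym.
have yx : adj y x by rewrite adj_sym.
have nxy : ~~ side c (c [set x; y]) x y by rewrite side_edge// eqxx.
have nxz : ~~ side c (c [set x; z]) x z by rewrite side_edge// eqxx.
have nyz : ~~ side c (c [set y; z]) y z by rewrite side_edge// eqxx.
have := side_split z nxy; have := side_split y nxz; have := side_split x nyz.
rewrite !side_edge// (setUC [set z] [set y]) (setUC [set y] [set x]) !negbK.
by case=> /eqP e1; case=> /eqP e2; case=> /eqP e3; congruence.
Qed.

Lemma md_le k :
  (forall c, md_coloring c -> ncolors c <= k) -> md G <= k.
Proof. by case: (md_ex G) => c mdc <-; apply. Qed.

Lemma edgesP (f : {set G}) :
  f \in edges G -> exists x y, f = [set x; y] /\ adj x y.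
Proof. by move=> /imsetP[[x y]]; rewrite inE /= => xy ->; exists x, y. Qed.

Lemma ncolors_ge (s : seq nat) c :
  uniq s -> (forall i, i \in s -> exists2 f, f \in edges G & c f = i) ->
  size s <= ncolors c.
Proof.
move=> us sP; apply: uniq_leq_size => // i /sP[f fE <-].
by rewrite mem_undup image_f.
Qed.

Lemma ncolors_edges c n : n <= ncolors c ->
  exists s : seq nat, [/\ size s = n, uniq s &
    forall i, i \in s -> exists x y, adj x y /\ c [set x; y] = i].
Proof.
move=> nc; exists (take n (undup [seq c f | f in edges G])); split.
- by rewrite size_takel.
- by rewrite take_uniq// undup_uniq.
move=> i /mem_take; rewrite mem_undup => /imageP[f /edgesP[x [y [-> xy]]] ->].
by exists x, y.
Qed.

End Sides.

(** * Components after the removal of a vertex *)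

Section Components.
Variable G : sgraph.
Implicit Types (H : subgraph G) (v x y : G).

(** The adjacency of G - v, kept on the vertex type of G; v becomes isolated. *)
Definition avoid (v : G) : rel G :=
  [rel x y | [&& adj x y, x != v & y != v]].

Lemma avoid_sym v : symmetric (avoid v).
Proof. by move=> x y; rewrite /avoid /= adj_sym (andbC (x != v)). Qed.

Lemma avoid_csym v : connect_sym (avoid v).
Proof. exact/sym_connect_sym/avoid_sym. Qed.

Lemma sadj_del_vertex v : sadj (del_vertices (whole G) [set v]) =2 avoid v.
Proof.
move=> x y; rewrite /sadj /avoid /= inE edgesE disjoint_sym disjoints1 !inE.
by rewrite negb_or ![v == _]eq_sym.
Qed.

Lemma sadj_csym H : connect_sym (sadj H).
Proof. by apply: sym_connect_sym => x y; rewrite /sadj /= setUC. Qed.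

Lemma sub_closed H : is_subgraph H -> closed (sadj H) H.1.
Proof.
move=> /andP[_ /forall_inP sub]; apply: intro_closed; first exact: sadj_csym.
by move=> x y /sub /subsetP sxy _; apply: sxy; rewrite set22.
Qed.

Lemma ncomp_le1 H :
  {in H.1 &, forall x y, connect (sadj H) x y} -> ncomp H <= 1.
Proof.
move=> conn; rewrite leqNgt; apply/negP => /card_gt1P[r [r' []]].
rewrite !inE => /andP[/eqP rr rH] /andP[/eqP rr' rH'].
move/eqP; apply; rewrite -rr -rr'.
by apply/eqP; rewrite root_connect ?conn//; apply: sadj_csym.
Qed.

Lemma root_in H x : is_subgraph H -> x \in H.1 ->
  fingraph.root (sadj H) x \in [predI fingraph.roots (sadj H) & mem H.1].
Proof.
move=> sH xH; rewrite !inE roots_root; last exact: sadj_csym.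
by rewrite -(closed_connect (sub_closed sH) (connect_root _ x)).
Qed.

Lemma ncomp_gt0 H x : is_subgraph H -> x \in H.1 -> 0 < ncomp H.
Proof.
move=> sH xH; apply/card_gt0P; exists (fingraph.root (sadj H) x).
exact: root_in.
Qed.

Lemma connect_ncomp1 H : is_subgraph H -> ncomp H <= 1 ->
  {in H.1 &, forall x y, connect (sadj H) x y}.
Proof.
move=> sH; rewrite leqNgt => /negP n1 x y xH yH.
rewrite -root_connect; last exact: sadj_csym.
apply/eqP/eqP; apply: contraT => rxy; case: n1; apply/card_gt1P.
by exists (fingraph.root (sadj H) x), (fingraph.root (sadj H) y); split=> //;
  apply: root_in.
Qed.

Lemma whole_sub : is_subgraph (whole G).
Proof.
by rewrite /is_subgraph subxx; apply/forall_inP => f _; apply: subsetT.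
Qed.

Lemma del_vertices_sub H X : is_subgraph H -> is_subgraph (del_vertices H X).
Proof.
move=> /andP[HE /forall_inP sub]; apply/andP; split.
  by apply: subset_trans HE; apply/subsetP => f; rewrite inE => /andP[].
apply/forall_inP => f; rewrite inE => /andP[/sub fH fX].
by rewrite /= subsetD fH.
Qed.

(** Either v is a vertex of H and not a cut-vertex of it, or deleting v does not
    change H. *)
Lemma nonseparable_minus H v : nonseparable H ->
  {in H.1 :\ v &, forall x y, connect (sadj (del_vertices H [set v])) x y}.
Proof.
move=> /and3P[sH /andP[_ /forall_inP cH] /forallP/(_ v)].
rewrite negb_and -leqNgt => ncut.
apply: (@connect_ncomp1 (del_vertices H [set v])).
  exact: del_vertices_sub.
have cH' : {in H.1 &, forall x y, connect (sadj H) x y}.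
  by move=> x y xH yH; have /forall_inP := cH x xH; apply.
have [vH|vH] := boolP (v \in H.1).
  by move: ncut; rewrite vH => /leq_trans; apply; apply: ncomp_le1.
apply: ncomp_le1 => x y; rewrite !inE => /andP[_ xH] /andP[_ yH].
rewrite (@eq_connect _ _ (sadj H)) ?cH'// => a b.
rewrite /sadj /= inE; case: (boolP ([set a; b] \in H.2)) => //= abH.
rewrite disjoint_sym disjoints1; apply: contra vH.
by apply/subsetP; have /andP[_ /forall_inP/(_ _ abH)] := sH.
Qed.

Lemma cut_vertex_separates v : cut_vertex (whole G) v ->
  exists x y, [/\ x != v, y != v & ~~ connect (avoid v) x y].
Proof.
move=> /andP[vT ncut].
suff /existsP[x /existsP[y /and3P[]]] :
  [exists x, exists y, [&& x != v, y != v & ~~ connect (avoid v) x y]].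
  by exists x, y.
apply: contraTT ncut => nsep; rewrite -leqNgt.
apply: leq_trans (ncomp_gt0 whole_sub vT); apply: ncomp_le1 => x y.
rewrite !inE !andbT => xv yv; rewrite (eq_connect (sadj_del_vertex v)).
apply: contraR nsep => nxy; apply/existsP; exists x; apply/existsP; exists y.
by rewrite xv yv.
Qed.

End Components.

(** * Three colors force a cut-vertex in diameter two *)

Section DiameterTwo.
Variable G : sgraph.
Hypothesis hdiam : has_diam G 2.
Implicit Types (c : {set G} -> nat) (x y z : G).

Lemma diam2_mid x y : x != y -> ~~ adj x y -> exists2 z, adj x z & adj z y.
Proof.
move=> xy nxy; have [/(_ x y)[k [kw _] k2] _] := hdiam.
move: kw; case/existsP => p.
case: k k2 p => [|[|[|//]]] _ p.
- by rewrite tuple0 /= (negPf xy).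
- case/tupleP: p => a p; rewrite tuple0 /= andbT => /andP[xa /eqP ay].
  by rewrite -ay xa in nxy.
case/tupleP: p => a p; case/tupleP: p => b p; rewrite tuple0 /= andbT.
by move=> /andP[/andP[xa ab] /eqP <-]; exists a.
Qed.

(** Along a path of at most two edges at most two coordinates change. *)
Lemma differ_in_two c i j k x y : md_coloring c ->
  ~~ side c i x y -> ~~ side c j x y -> ~~ side c k x y ->
  [|| i == j, j == k | i == k].
Proof.
move=> mdc.
case: (eqVneq x y) => [->|xy]; first by rewrite side_refl.
have [axy|naxy] := boolP (adj x y).
  by rewrite !side_edge// !negbK => /eqP-> /eqP-> _; rewrite eqxx.
have [z xz zy] := diam2_mid xy naxy.
move=> /(side_split z)+ /(side_split z)+ /(side_split z).
rewrite !side_edge// !negbK.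
by do 3![case=> /eqP <-]; rewrite !eqxx ?orbT.
Qed.

(** An edge ba of a third color p would make a differ from v in i, j and p,
    three coordinates, since b and v already agree on p. *)
Lemma edge_colored_by_difference c i j b a v : md_coloring c ->
  i != j -> ~~ side c i b v -> ~~ side c j b v -> adj b a ->
  (c [set b; a] == i) || (c [set b; a] == j).
Proof.
move=> mdc ij bi bj ba; apply: contraT; rewrite negb_or => /andP[pi pj].
set p := c [set b; a] in pi pj *.
have keepD k : p != k -> ~~ side c k b v -> ~~ side c k a v.
  by move=> pk; rewrite -(@side_congl _ _ _ b a)// side_edge.
have bp : side c p b v.
  apply: contraT => bp; have := differ_in_two mdc bi bj bp.
  by rewrite (negPf ij) eq_sym (negPf pj) (eq_sym i) (negPf pi).
have ap : ~~ side c p a v.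
  apply/negP => av; have : side c p b a.
    by apply: side_trans bp _; rewrite side_sym.
  by rewrite side_edge// eqxx.
have := differ_in_two mdc (keepD i pi bi) (keepD j pj bj) ap.
by rewrite (negPf ij) eq_sym (negPf pj) (eq_sym i) (negPf pi).
Qed.

(** If each vertex met one color only, the color would be constant along the
    path of length at most two from x to u. *)
Lemma bicolored_vertex c x y u w :
  adj x y -> adj u w -> c [set x; y] != c [set u; w] ->
  exists b a d, [/\ adj b a, adj b d & c [set b; a] != c [set b; d]].
Proof.
move=> xy uw ne; case: (eqVneq x u) => [xu|xu].
  by subst u; exists x, y, w.
have [axu|naxu] := boolP (adj x u).
  have aux : adj u x by rewrite adj_sym.
  case: (eqVneq (c [set x; u]) (c [set x; y])) => [e|ne'].
    by exists u, x, w; split=> //; rewrite setUC e.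
  by exists x, u, y.
have [z xz zu] := diam2_mid xu naxu.
have zx : adj z x by rewrite adj_sym.
have uz : adj u z by rewrite adj_sym.
case: (eqVneq (c [set x; z]) (c [set x; y])) => [e1|]; last by exists x, z, y.
case: (eqVneq (c [set u; z]) (c [set u; w])) => [e2|]; last by exists u, z, w.
by exists z, x, u; split=> //; rewrite setUC e1 (setUC [set z]) e2.
Qed.

(** A path of length two from b to v that changed another coordinate first
    would have to restore it and change r with a single edge. *)
Lemma edge_of_only_difference c r b v : md_coloring c ->
  ~~ side c r b v -> (forall s, s != r -> side c s b v) ->
  exists2 a, adj b a & c [set b; a] = r.
Proof.
move=> mdc nr only.
have bv : b != v by apply: contraNneq nr => ->; apply: side_refl.
have [abv|nabv] := boolP (adj b v).
  by exists v => //; apply/eqP; move: nr; rewrite side_edge// negbK.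
have [m bm mv] := diam2_mid bv nabv; exists m => //; apply/eqP.
apply: contraT => pr; have bpv := only _ pr.
have mpv : ~~ side c (c [set b; m]) m v.
  apply/negP => mpv; have : side c (c [set b; m]) b m.
    by apply: side_trans bpv _; rewrite side_sym.
  by rewrite side_edge// eqxx.
case: (side_split m nr); rewrite side_edge// negbK; first by rewrite (negPf pr).
by move: mpv; rewrite side_edge// negbK => /eqP->; rewrite (negPf pr).
Qed.

(** The vertices other than b each differ from b in a single coordinate, which is
    constant on the components of G - b; a and d are neighbors of b along edges
    of different colors. *)
Lemma three_colors_separated c : md_coloring c -> 2 < ncolors c ->
  exists b a d : G, [/\ a != b, d != b & ~~ connect (avoid b) a d].
Proof.
move=> mdc /ncolors_edges[s [ss us sP]].
have si i : i < 3 -> nth 0 s i \in s by move=> i3; rewrite mem_nth// ss.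
have [x [y [xy cxy]]] := sP _ (si 0 isT).
have [u [w [uw cuw]]] := sP _ (si 1 isT).
have [|b [a [d [ba bd pq]]]] := bicolored_vertex (c := c) xy uw.
  by rewrite cxy cuw nth_uniq ?ss.
set p := c [set b; a] in pq; set q := c [set b; d] in pq.
(* Pigeonhole: three colors do not fit into two. *)
have [r rP [rp rq]] : exists2 r, r \in s & r != p /\ r != q.
  suff /hasP[r rs] : has (predC (mem [:: p; q])) s.
    by rewrite /= !inE negb_or => /andP[]; exists r.
  rewrite has_predC; apply: contraTN isT => /allP /(uniq_leq_size us).
  by rewrite ss.
have [v nr] : exists v, ~~ side c r b v.
  have [u' [w' [uw' cuw']]] := sP r rP.
  have : ~~ side c r u' w' by rewrite side_edge// cuw' eqxx.
  by case/(side_split b); [rewrite side_sym; exists u' | exists w'].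
have [|e be ce] := edge_of_only_difference mdc nr.
  move=> t tr; apply: contraT => nt.
  have := edge_colored_by_difference mdc tr nt nr ba.
  have := edge_colored_by_difference mdc tr nt nr bd.
  rewrite -/p -/q ![_ == r]eq_sym (negPf rp) (negPf rq) !orbF.
  by move=> /eqP qt /eqP pt; rewrite pt qt eqxx in pq.
(* Two coordinates would be the only colors at b, which has three. *)
have one i j w' : ~~ side c i b w' -> ~~ side c j b w' -> i = j.
  move=> ni nj; apply/eqP; apply: contraT => ij.
  have := edge_colored_by_difference mdc ij ni nj ba.
  have := edge_colored_by_difference mdc ij ni nj bd.
  have := edge_colored_by_difference mdc ij ni nj be.
  rewrite -/p -/q ce; move: pq rp rq.
  move=> pq' rp' rq' /orP[]/eqP e1 /orP[]/eqP e2 /orP[]/eqP e3;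
    by move: pq' rp' rq'; rewrite ?e1 ?e2 ?e3 ?eqxx.
exists b, a, d; split.
- by apply: contraTneq ba => ->; rewrite adj_irr.
- by apply: contraTneq bd => ->; rewrite adj_irr.
(* A walk avoiding b stays among the vertices that differ from b in p: an
   edge to a vertex differing in another coordinate m would change both. *)
have cl : closed (avoid b) [pred z | ~~ side c p b z].
  apply: intro_closed; first exact: avoid_csym.
  move=> z z' /and3P[zz' _ z'b] /[!inE] pz.
  have /md_coloringP[_ /(_ b z')] := mdc.
  case=> [|m mz']; first by rewrite eq_sym.
  case: (eqVneq m p) => [<-//|mp].
  apply/negP => pz'.
  have pzz' : ~~ side c p z z'.
    by apply: contra pz => pzz'; apply: side_trans pz' _; rewrite side_sym.
  have mz : side c m b z.
    by apply: contraT => mz; rewrite (one m p z mz pz) eqxx in mp.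
  have mzz' : ~~ side c m z z'.
    by apply: contra mz' => mzz'; apply: side_trans mz _.
  move: pzz' mzz'; rewrite !side_edge// !negbK => /eqP-> /eqP pm.
  by rewrite pm eqxx in mp.
apply/negP => /(closed_connect cl); rewrite !inE !side_edge// !negbK.
by rewrite -/p -/q eqxx eq_sym (negPf pq).
Qed.

Lemma two_connected_md : k_connected G 2 -> md G <= 2.
Proof.
move=> [_ conn]; apply: md_le => c mdc; rewrite leqNgt; apply/negP => c3.
have [b [a [d [ab db]]]] := three_colors_separated mdc c3.
have [|_ /forall_inP/(_ a)] := andP (conn [set b] _); first by rewrite cards1.
rewrite !inE andbT => /(_ ab) /forall_inP/(_ d).
by rewrite !inE andbT (eq_connect (sadj_del_vertex b)) => /(_ db) ->.
Qed.

(** * Nonadjacent vertices with two common neighbors *)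

Section TwoCommonNeighbors.
Hypothesis common2 : forall x y : G, x != y -> ~~ adj x y ->
  2 <= #|[set z | adj x z && adj y z]|.

Lemma common2_md : md G <= 2.
Proof.
apply: md_le => c mdc; rewrite leqNgt; apply/negP => c3.
have [b [a [d [ab db nad]]]] := three_colors_separated mdc c3.
have adP x y : x != b -> y != b -> adj x y -> connect (avoid b) x y.
  by move=> xb yb xy; apply: connect1; rewrite /avoid /= xy xb.
have ad : a != d by apply: contraNneq nad => ->; apply: connect0.
have [|naad] := boolP (adj a d).
  by move=> /(adP _ _ ab db); rewrite (negPf nad).
suff /subset_leq_card : [set z | adj a z && adj d z] \subset [set b].
  by rewrite cards1 leqNgt common2.
apply/subsetP => z; rewrite !inE => /andP[az dz]; apply: contraNT nad => zb.
by apply: connect_trans (adP _ _ ab zb az) (adP _ _ zb db _); rewrite adj_sym.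
Qed.

(** A common neighbor of x and w is reached from x by changing p or by changing
    q. In the first case it has the q-coordinate of x, the p-coordinate of w and
    the common values elsewhere, which determines it; so at least one of two
    common neighbors is of the second kind, which is the one sought. *)
Lemma corner c p q x w : md_coloring c -> p != q ->
  ~~ side c p x w -> ~~ side c q x w ->
  exists z, [/\ adj x z, side c p x z & side c q z w].
Proof.
move=> mdc pq px qx.
have xw : x != w by apply: contraNneq px => ->; apply: side_refl.
have nxw : ~~ adj x w.
  apply: contra pq => xw'; move: px qx; rewrite !side_edge// !negbK.
  by move=> /eqP-> /eqP->.
have /card_gt1P[z1 [z2 []]] := common2 xw nxw.
rewrite !inE ![adj w _]adj_sym => /andP[xz1 z1w] /andP[xz2 z2w] z12.
have typ z : adj x z -> adj z w -> c [set x; z] = q /\ c [set z; w] = p \/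
    c [set x; z] = p /\ c [set z; w] = q.
  move=> xz zw; move: (side_split z px) (side_split z qx).
  rewrite !side_edge// !negbK; case=> /eqP e1 [] /eqP e2; [|by right|by left|];
    by rewrite -e1 -e2 eqxx in pq.
have good z : adj x z -> adj z w -> c [set x; z] = q -> c [set z; w] = p ->
    exists z, [/\ adj x z, side c p x z & side c q z w].
  by move=> xz zw cq cp; exists z; rewrite !side_edge// cq cp eq_sym.
have [[c1 c1']|[c1 c1']] := typ _ xz1 z1w; first exact: good c1 c1'.
have [[c2 c2']|[c2 c2']] := typ _ xz2 z2w; first exact: good c2 c2'.
have /md_coloringP[_ /(_ z1 z2 z12)[i]] := mdc.
case: (eqVneq i p) => [->|ip].
  case/(side_split w); first by rewrite side_edge// c1' eq_sym pq.
  by rewrite side_sym side_edge// c2' eq_sym pq.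
case/(side_split x); last by rewrite side_edge// c2 eq_sym ip.
by rewrite side_sym side_edge// c1 eq_sym ip.
Qed.

(** A vertex w with the p-coordinate of y and another q-coordinate turns y into
    the missing corner of the rectangle spanned by x and w; corners are adjacent
    to x. *)
Lemma same_coordinate_adj c p q x y : md_coloring c -> p != q ->
  (forall u w, side c p u w -> side c q u w -> u = w) ->
  (exists b, ~~ side c q x b) -> x != y -> side c q x y -> adj x y.
Proof.
move=> mdc pq inj [b qxb] xy qxy.
have pxy : ~~ side c p x y by apply: contraNN xy => /inj /(_ qxy) ->.
have qyb : ~~ side c q y b by rewrite -(side_congl _ qxy).
(* If b differs from y in both coordinates, take a corner in its place. *)
have [w pyw qyw] : exists2 w, side c p y w & ~~ side c q y w.
  have [pyb|pyb] := boolP (side c p y b); first by exists b.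
  have [w [_ pyw qwb]] := corner mdc pq pyb qyb; exists w => //.
  by apply: contra qyb => /side_trans; apply.
have pxw : ~~ side c p x w.
  by rewrite side_sym -(side_congl _ pyw) side_sym.
have qxw : ~~ side c q x w by rewrite (side_congl _ qxy).
have qp : q != p by rewrite eq_sym.
have [z [xz qxz pzw]] := corner mdc qp qxw pxw.
suff <- : z = y by [].
apply: inj; last by rewrite -(side_congl _ qxz).
by apply: side_trans pzw _; rewrite side_sym.
Qed.

(** The classes of [side c p] and [side c q] serve as the two coordinates; they
    are numbered through their canonical roots. *)
Lemma product_of_md2 : md G = 2 -> exists s t : nat,
  [/\ 2 <= s, 2 <= t & isomorphic G (cartesian (complete s) (complete t))].
Proof.
have [c mdc <-] := md_ex G => c2.
have [s [ss us sP]] := @ncolors_edges G c 2 (eq_leq (esym c2)).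
move: s ss us sP => [|p [|q []]]//= _; rewrite inE andbT => pq sP.
have qp : q != p by rewrite eq_sym.
have [x1 [y1 [xy1 c1]]] := sP p (mem_head _ _).
have [|x2 [y2 [xy2 c2']]] := sP q; first by rewrite !inE eqxx orbT.
(* A further color would be a third one, but md G is two. *)
have colE x y : adj x y -> (c [set x; y] == p) || (c [set x; y] == q).
  move=> xy; rewrite -mem_seq2; apply: contraT => npq.
  have /= := @ncolors_ge G [:: c [set x; y]; p; q] c; rewrite c2.
  apply; first by rewrite /= npq /= inE pq.
  move=> i; rewrite inE => /orP[/eqP->|/sP[u [w [uw <-]]]].
    by exists [set x; y]; rewrite ?edgesE.
  by exists [set u; w]; rewrite ?edgesE.
have inj x y : side c p x y -> side c q x y -> x = y.
  move=> pxy qxy; apply/eqP; apply: contraT => xy.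
  have /md_coloringP[_ /(_ x y xy)[i]] := mdc.
  case: (eqVneq i p) => [->|ip]; first by rewrite pxy.
  case: (eqVneq i q) => [->|iq]; first by rewrite qxy.
  have eI u w : adj u w -> side c i u w.
    by move=> uw; rewrite side_edge//; case/orP: (colE _ _ uw) => /eqP->;
      rewrite eq_sym.
  have [axy|naxy] := boolP (adj x y); first by rewrite eI.
  have [z xz zy] := diam2_mid xy naxy.
  by rewrite (side_trans (eI _ _ xz) (eI _ _ zy)).
have inj' x y : side c q x y -> side c p x y -> x = y by move=> ? ?; apply: inj.
have ex i u w : adj u w -> c [set u; w] = i ->
    forall x, exists b, ~~ side c i x b.
  move=> uw ci x; have : ~~ side c i u w by rewrite side_edge// ci eqxx.
  by case/(side_split x) => ?; [exists u; rewrite side_sym | exists w].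
pose cls i := [set fingraph.root (other_colors c i) x | x : G].
have clsP i x : fingraph.root (other_colors c i) x \in cls i by apply: imset_f.
pose rk i x : 'I_#|cls i| :=
  enum_rank_in (clsP i x1) (fingraph.root (other_colors c i) x).
have rkE i x y : (rk i x == rk i y) = side c i x y.
  rewrite /side -root_connect; last exact: side_csym.
  apply/eqP/eqP => [|e]; last by rewrite /rk e.
  by apply: enum_rank_in_inj.
have card_cls i u w : adj u w -> c [set u; w] = i -> 1 < #|cls i|.
  move=> uw ci; apply/card_gt1P.
  exists (fingraph.root (other_colors c i) u).
  exists (fingraph.root (other_colors c i) w).
  split=> //; rewrite root_connect; last exact: side_csym.
  by rewrite -/(side c i u w) side_edge// ci eqxx.
pose f x : cartesian (complete #|cls p|) (complete #|cls q|) :=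
  (rk p x, rk q x).
exists #|cls p|, #|cls q|; split; [exact: card_cls c1|exact: card_cls c2'|].
exists f; last first.
  move=> x y; rewrite /= /cart_adj /= /K_adj /= !rkE.
  have [->|xy] := eqVneq x y; first by rewrite !side_refl adj_irr.
  have [axy|naxy] := boolP (adj x y).
    rewrite !side_edge// !negbK; case/orP: (colE _ _ axy) => /eqP->.
      by rewrite eqxx pq.
    by rewrite eqxx qp orbT.
  apply/negP => /orP[] /andP[_ sxy]; move/negP: naxy; apply.
    by apply: (same_coordinate_adj mdc pq inj _ xy sxy); apply: ex c2' _.
  by apply: (same_coordinate_adj mdc qp inj' _ xy sxy); apply: ex c1 _.
have f_inj : injective f.
  by move=> x y [] /eqP; rewrite rkE => px /eqP; rewrite rkE; apply: inj.
have f_surj ij : exists x, f x == ij.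
  case: ij => i j.
  have rk_surj k (l : 'I_#|cls k|) : exists x, rk k x = l.
    have /imsetP[x _ lx] := enum_valP l; exists x.
    by rewrite /rk -lx enum_valK_in.
  have [x <-] := rk_surj p i; have [y <-] := rk_surj q j.
  have goal z : side c p z x -> side c q z y ->
      exists z', f z' == (rk p x, rk q y).
    by move=> pz qz; exists z; rewrite xpair_eqE /= !rkE pz.
  (* All pairs of coordinates occur: x, y or a corner between them has them. *)
  have [pxy|pxy] := boolP (side c p x y).
    by apply: (goal y); rewrite ?side_refl// side_sym.
  have [qxy|qxy] := boolP (side c q x y).
    by apply: (goal x); rewrite ?side_refl.
  have [z [_ pxz qzy]] := corner mdc pq pxy qxy.
  by apply: (goal z) => //; rewrite side_sym.
exists (fun ij => xchoose (f_surj ij)) => [x|ij].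
  by apply: f_inj; apply/eqP; exact: (xchooseP (f_surj _)).
by apply/eqP; exact: (xchooseP (f_surj _)).
Qed.

End TwoCommonNeighbors.

(** * Graphs with a cut-vertex *)

Section CutVertex.
Variable v : G.
Hypothesis vcut : cut_vertex (whole G) v.

(** Some vertex u lies outside the component of z in G - v, and the middle of
    a path of length two from z to u can only be v. *)
Lemma cut_vertex_universal z : z != v -> adj v z.
Proof.
move=> zv; have [x [y [xv yv nxy]]] := cut_vertex_separates vcut.
have [u uv nzu] : exists2 u, u != v & ~~ connect (avoid v) z u.
  have [zx|] := boolP (connect (avoid v) z x); last by exists x.
  exists y => //; apply: contra nxy; apply: connect_trans.
  by rewrite (avoid_csym v).
have zu : z != u by apply: contraNneq nzu => ->; apply: connect0.
have adP a b : a != v -> b != v -> adj a b -> connect (avoid v) a b.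
  by move=> av bv ab; apply: connect1; rewrite /avoid /= ab av.
have [azu|nazu] := boolP (adj z u); first by rewrite adP in nzu.
have [m zm mu] := diam2_mid zu nazu.
have [<-|mv] := eqVneq m v; first by rewrite adj_sym.
move/negP: nzu; case.
by apply: connect_trans (adP _ _ zv mv zm) (adP _ _ mv uv mu).
Qed.

(** For x <> v this is the vertex set of the block that contains the edge vx. *)
Definition lobe x : {set G} := v |: [set y | connect (avoid v) x y].

Definition lobe_graph x : subgraph G :=
  (lobe x, [set f in edges G | f \subset lobe x]).

Lemma sadj_lobe x y z :
  sadj (lobe_graph x) y z = [&& adj y z, y \in lobe x & z \in lobe x].
Proof. by rewrite /sadj /= inE edgesE subUset !sub1set. Qed.

Lemma connect_avoid_neq x y : x != v -> connect (avoid v) x y -> y != v.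
Proof.
move=> xv xy; have cl : closed (avoid v) (predC1 v).
  by move=> a b /and3P[_ av bv]; rewrite !inE av bv.
by have := closed_connect cl xy; rewrite !inE xv => <-.
Qed.

Lemma lobe_eq x y : connect (avoid v) x y -> lobe_graph x = lobe_graph y.
Proof.
move=> xy; have e : lobe x = lobe y.
  by apply/setP => z; rewrite !inE (same_connect (avoid_csym v) xy).
by rewrite /lobe_graph e.
Qed.

Lemma mem_lobe x y : y != v -> (y \in lobe x) = connect (avoid v) x y.
Proof. by move=> yv; rewrite !inE (negPf yv). Qed.

(** All other vertices of a lobe are adjacent to v, which keeps the lobe
    connected when one of them is deleted; deleting v leaves a component of
    G - v. *)
Lemma lobe_nonseparable x : x != v -> nonseparable (lobe_graph x).
Proof.
move=> xv; have sB : is_subgraph (lobe_graph x).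
  apply/andP; split; last by apply/forall_inP => f; rewrite inE => /andP[].
  by apply/subsetP => f; rewrite inE => /andP[].
have vB : v \in lobe x by rewrite !inE eqxx.
apply/and3P; split=> //.
  have toV y : y \in lobe x -> connect (sadj (lobe_graph x)) y v.
    have [->|yv yB] := eqVneq y v; first by rewrite connect0.
    by apply: connect1; rewrite sadj_lobe yB vB adj_sym cut_vertex_universal.
  rewrite /connected; apply/andP; split; first by apply/set0Pn; exists v.
  apply/forall_inP => y yB; apply/forall_inP => z zB.
  by apply: connect_trans (toV y yB) _; rewrite sadj_csym toV.
apply/forallP => u; apply/negP => /andP[_]; apply/negP; rewrite -leqNgt.
apply: leq_trans (ncomp_gt0 sB vB); apply: ncomp_le1.
have delE y z : sadj (del_vertices (lobe_graph x) [set u]) y z =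
    [&& sadj (lobe_graph x) y z, y != u & z != u].
  rewrite {1}/sadj /= inE disjoint_sym disjoints1 !inE negb_or.
  by rewrite ![u == _]eq_sym /sadj /= inE.
case: (eqVneq u v) delE => [->|uv] delE.
  move=> y z; rewrite in_setD in_set1 => /andP[yv yB].
  rewrite in_setD in_set1 => /andP[zv zB].
  have : connect (avoid v) y z.
    by rewrite -(same_connect (avoid_csym v) (y := y) (x := x)) -?mem_lobe.
  move=> /connectP[p pP ->]; elim: p y pP {yv z zv zB} yB => [|a p IH] y /=.
    by rewrite connect0.
  move=> /andP[ya pP] yB; have /and3P[ya' yv av] := ya.
  have aB : a \in lobe x.
    rewrite mem_lobe//; apply: connect_trans (connect1 ya).
    by rewrite -mem_lobe.
  apply: connect_trans (IH a pP aB); apply: connect1.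
  by rewrite delE sadj_lobe ya' yB aB yv.
have toV y : y \in lobe x -> y != u ->
    connect (sadj (del_vertices (lobe_graph x) [set u])) y v.
  have [->|yv yB yu] := eqVneq y v; first by rewrite connect0.
  apply: connect1; rewrite delE sadj_lobe yB vB adj_sym.
  by rewrite cut_vertex_universal// yu eq_sym uv.
move=> y z; rewrite in_setD in_set1 => /andP[yu yB].
rewrite in_setD in_set1 => /andP[zu zB].
by apply: connect_trans (toV y yB yu) _; rewrite sadj_csym toV.
Qed.

(** Deleting v leaves a nonseparable graph connected, hence inside a single
    component of G - v; if nothing but v remains of it, any lobe contains it. *)
Lemma nonseparable_in_lobe (K : subgraph G) :
  nonseparable K -> exists2 x, x != v & le_subgraph K (lobe_graph x).
Proof.
move=> nsK; have /and3P[/andP[KE /forall_inP sK] _ _] := nsK.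
suff [x xv /subsetP Kx] : exists2 x, x != v & K.1 \subset lobe x.
  exists x => //; apply/andP; split; first exact/subsetP.
  apply/subsetP => f fK; rewrite inE (subsetP KE)//=.
  by apply: subset_trans (sK f fK) _; apply/subsetP.
have [K0|[x]] := set_0Vmem (K.1 :\ v).
  have [x [_ [xv _ _]]] := cut_vertex_separates vcut; exists x => //.
  apply/subsetP => y yK; rewrite !inE; case: eqVneq => //= yv.
  by have := in_set0 y; rewrite -K0 !inE yv yK.
move=> xK; have /setD1P[xv _] := xK; exists x => //.
apply/subsetP => y yK; have [->|yv] := eqVneq y v; first by rewrite !inE eqxx.
have yK' : y \in K.1 :\ v by rewrite !inE yv.
rewrite mem_lobe//; apply: connect_sub (nonseparable_minus nsK xK yK') => a b.
rewrite /sadj /= inE disjoint_sym disjoints1 !inE negb_or => /andP[abK].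
move=> /andP[va vb]; apply: connect1; rewrite /avoid /= -edgesE (subsetP KE)//.
by rewrite eq_sym va eq_sym.
Qed.

Lemma blocksE :
  [set H : subgraph G | block H] = [set lobe_graph x | x in [set~ v]].
Proof.
have le_anti (H K : subgraph G) : le_subgraph H K -> le_subgraph K H -> H = K.
  case: H K => [H1 H2] [K1 K2] /andP[/= a b] /andP[/= a' b'].
  by congr pair; apply/eqP; rewrite eqEsubset ?a ?a' ?b ?b'.
apply/setP => H; rewrite inE; apply/andP/imsetP => [[nsH /forallP maxH]|[x]].
  have [x xv Hx] := nonseparable_in_lobe nsH; exists x; first by rewrite !inE.
  have := maxH (lobe_graph x); rewrite lobe_nonseparable// Hx /=.
  by move=> /eqP.
rewrite !inE => xv ->; split; first exact: lobe_nonseparable.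
apply/forallP => K; apply/implyP => nsK; apply/implyP => xK.
have [y yv Ky] := nonseparable_in_lobe nsK.
have xy : connect (avoid v) y x.
  rewrite -mem_lobe//; have /andP[/subsetP + _] := xK => xK1.
  by have /andP[/subsetP + _] := Ky;
    apply; apply: xK1; rewrite mem_lobe// connect0.
by apply/eqP/le_anti => //; rewrite -(lobe_eq xy).
Qed.

(** One representative for each component of G - v. *)
Definition branches : {set G} :=
  [set fingraph.root (avoid v) x | x in [set~ v]].

Lemma nblocksE : nblocks G = #|branches|.
Proof.
rewrite /nblocks blocksE.
have -> : [set lobe_graph x | x in [set~ v]] =
    [set lobe_graph r | r in branches].
  rewrite -imset_comp; apply: eq_imset => x /=.
  exact/lobe_eq/connect_root.
apply: card_in_imset => r r' /imsetP[x xv ->] /imsetP[y yv ->] [e _].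
have neq z : z \in [set~ v] -> fingraph.root (avoid v) z != v.
  by rewrite !inE => zv; apply: connect_avoid_neq zv (connect_root _ _).
have : fingraph.root (avoid v) y \in lobe (fingraph.root (avoid v) x).
  by rewrite e mem_lobe ?neq ?connect0.
rewrite mem_lobe ?neq// -(root_connect (avoid_csym v)) !root_root;
  try exact: avoid_csym.
by move/eqP.
Qed.

(** The color of vx is constant on the component of x, by the triangles vxy, and
    every edge has the color of such a spoke. *)
Lemma ncolors_cut_vertex c : md_coloring c -> ncolors c <= #|branches|.
Proof.
move=> mdc; have star x y : x != v -> connect (avoid v) x y ->
    c [set v; x] = c [set v; y].
  move=> xv xy; apply/eqP.
  suff /closed_connect/(_ _ _ xy) :
      closed (avoid v) [pred z | c [set v; z] == c [set v; x]].
    by rewrite !inE eqxx eq_sym => <-.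
  move=> a b /and3P[ab av bv]; rewrite !inE (triangle_mono mdc _ ab)//;
    exact: cut_vertex_universal.
rewrite cardE -(size_map (fun r => c [set v; r])); apply: uniq_leq_size.
  exact: undup_uniq.
move=> i; rewrite mem_undup => /imageP[f fE ->{i}].
have [x [xv ->]] : exists x, x != v /\ c f = c [set v; x].
  move: fE => /edgesP[x [y [-> xy]]]; have [xv|xv] := eqVneq x v.
    exists y; split; last by rewrite xv.
    by apply: contraTneq xy => ->; rewrite xv adj_irr.
  exists x; split=> //; rewrite (setUC [set v]).
  have [->//|yv] := eqVneq y v.
  apply: triangle_mono => //; rewrite adj_sym;
    by apply: cut_vertex_universal.
apply/mapP; exists (fingraph.root (avoid v) x).
  by rewrite mem_enum; apply: imset_f; rewrite !inE.
by apply: star => //; apply: connect_root.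
Qed.

(** An edge gets the number of the component of G - v that its ends other than v
    belong to; the successor keeps colors positive. *)
Definition branch_coloring (f : {set G}) : nat :=
  if [pick z in f :\ v] is Some z
  then (enum_rank (fingraph.root (avoid v) z)).+1
  else 1.

Lemma branch_coloringE x y : adj x y -> x != v ->
  branch_coloring [set x; y] = (enum_rank (fingraph.root (avoid v) x)).+1.
Proof.
move=> xy xv; rewrite /branch_coloring; case: pickP => [z|/(_ x)]; last first.
  by rewrite !inE xv eqxx.
rewrite !inE => /andP[zv] /orP[/eqP->//|/eqP zy]; rewrite {}zy in zv *.
congr (enum_rank _).+1; apply/eqP; rewrite (root_connect (avoid_csym v)).
by rewrite (avoid_csym v); apply: connect1; rewrite /avoid /= xy xv.
Qed.

(** All edges at a vertex x <> v have the same color; removing it isolates x. *)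
Lemma branch_coloring_md : md_coloring branch_coloring.
Proof.
have isolated x y : x != v -> x != y -> exists i, ~~ side branch_coloring i x y.
  move=> xv xy; exists (enum_rank (fingraph.root (avoid v) x)).+1.
  apply/negP => /connectP[[|a p] /=]; first by move=> _ e; rewrite e eqxx in xy.
  by move=> /andP[/andP[xa]]; rewrite branch_coloringE// eqxx.
apply/md_coloringP; split=> [f _|x y xy].
  by rewrite /branch_coloring; case: pickP.
have [xv|] := eqVneq x v; last by move=> xv; apply: isolated.
have yx : y != x by rewrite eq_sym.
have [|i] := isolated y x _ yx; first by rewrite -xv.
by rewrite side_sym; exists i.
Qed.

Lemma ncolors_branch_coloring : #|branches| <= ncolors branch_coloring.
Proof.
rewrite cardE -(size_map (fun r : G => (enum_rank r).+1)).
apply: ncolors_ge.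
  rewrite map_inj_uniq ?enum_uniq// => r r' [/ord_inj/enum_rank_inj].
  exact.
move=> i /mapP[r]; rewrite mem_enum => /imsetP[x]; rewrite !inE => xv -> ->.
have xv' : adj x v by rewrite adj_sym cut_vertex_universal.
by exists [set x; v]; rewrite ?edgesE ?branch_coloringE.
Qed.

Lemma cut_vertex_md : md G = nblocks G.
Proof.
rewrite nblocksE; apply/eqP; rewrite eqn_leq; apply/andP; split.
  by apply: md_le => c; apply: ncolors_cut_vertex.
exact: leq_trans ncolors_branch_coloring (md_max branch_coloring_md).
Qed.

End CutVertex.

End DiameterTwo.

(** * Products of complete graphs *)

(** The color of an edge is the number of distinct first coordinates of its
    ends: 2 if it changes the first coordinate, 1 if it changes the second.
    The edges changing a coordinate separate the vertices that differ in it. *)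
Lemma md2_of_product (G : sgraph) s t : 2 <= s -> 2 <= t ->
  isomorphic G (cartesian (complete s) (complete t)) -> 2 <= md G.
Proof.
move=> s2 t2 [h [h' hK h'K] hadj].
pose c (f : {set G}) := #|[set (h z).1 | z in f]|.
have cE x y : c [set x; y] = ((h x).1 != (h y).1).+1.
  by rewrite /c imsetU1 imset_set1 cards2.
have adjE x y : adj x y =
    ((h x).1 != (h y).1) && ((h x).2 == (h y).2)
    || ((h x).2 != (h y).2) && ((h x).1 == (h y).1).
  by rewrite -hadj.
have mdc : md_coloring c.
  apply/md_coloringP; split=> [_ /edgesP[x [y [-> _]]]|x y xy].
    by rewrite cE.
  have hxy : h x != h y by rewrite (can_eq hK).
  have [e1|n1] := eqVneq (h x).1 (h y).1.
    exists 1; apply/negP.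
    move=> /(@closed_connect _ _ [pred z | (h z).2 == (h x).2]).
    rewrite !inE eqxx => sx.
    have e2 : (h y).2 == (h x).2.
      rewrite -sx// => u w /andP[]; rewrite adjE cE !inE.
      by case: (eqVneq (h u).1 (h w).1) => _ //=;
        rewrite ?andbF ?orbF ?andbT // => /eqP->.
    by move: hxy; rewrite [h x]surjective_pairing [h y]surjective_pairing
      e1 (eqP e2) eqxx.
  exists 2; apply/negP => /(@closed_connect _ _ [pred z | (h z).1 == (h x).1]).
  rewrite !inE eqxx => sx; suff : (h y).1 == (h x).1.
    by rewrite eq_sym (negPf n1).
  rewrite -sx// => u w /andP[]; rewrite adjE cE !inE.
  by case: (eqVneq (h u).1 (h w).1) => [->|_] //=.
apply: leq_trans (md_max mdc).
pose i0 : 'I_s := Ordinal (ltnW s2); pose i1 : 'I_s := Ordinal s2.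
pose j0 : 'I_t := Ordinal (ltnW t2); pose j1 : 'I_t := Ordinal t2.
apply: (@ncolors_ge _ [:: 2; 1]) => // i.
rewrite !inE => /orP[]/eqP->.
  by exists [set h' (i0, j0); h' (i1, j0)]; rewrite ?edgesE ?adjE ?cE !h'K.
by exists [set h' (i0, j0); h' (i0, j1)]; rewrite ?edgesE ?adjE ?cE !h'K.
Qed.

(** * Monochromatic disconnection in diameter two *)

Theorem theorem3p1 (G : sgraph) (hdiam : has_diam G 2) :
  [/\ (exists v : G, cut_vertex (whole G) v) -> md G = nblocks G,
      k_connected G 2 -> md G <= 2
    & (forall x y : G, x != y -> ~~ adj x y ->
         2 <= #|[set z | adj x z && adj y z]|) ->
      md G <= 2 /\
      (md G = 2 <->
       exists s t : nat,
         [/\ 2 <= s, 2 <= t & isomorphic G (cartesian (complete s) (complete t))])].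
Proof.
split=> [[v vcut]||common2]; first exact: (cut_vertex_md hdiam vcut).
  exact: two_connected_md.
have le2 := common2_md hdiam common2; split=> //; split.
  exact: product_of_md2.
move=> [s [t [s2 t2 iso]]]; apply/eqP; rewrite eqn_leq le2.
exact: md2_of_product iso.
Qed.
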